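(* Let $r_1,r_2>0$ be real numbers, let $C_1$ be the circle $(x+r_1)^2+y^2=r_1^2$ and $C_2$ the circle $(x-r_2)^2+y^2=r_2^2$. For real $w\neq 0,\pm1$ let $C_3=C_3(w)$ be the circle $$\left(x-\frac{r_1-r_2}{z^2-1}\right)^2+\left(y-\frac{2z\sqrt{r_1r_2}}{z^2-1}\right)^2=\left(\frac{r_1+r_2}{z^2-1}\right)^2,\qquad z=\frac1w,$$ which touches $C_1$ and $C_2$. Put $D=r_1r_2+2\sqrt{r_1r_2}\,(r_1+r_2)w+(r_1^2+r_1r_2+r_2^2)w^2$ and assume $D\neq0$. Put $$x_4=\frac{r_1r_2(r_1-r_2)w^2}{D},\qquad y_4=\frac{2r_1r_2\left(\sqrt{r_1r_2}+(r_1+r_2)w\right)w}{D},\qquad r_4=\frac{r_1r_2(r_1+r_2)w^2}{D}.$$ Then: (i) The circle $C_4:(x-x_4)^2+(y-y_4)^2=r_4^2$ touches $C_1$, $C_2$ and $C_3$. (ii) A point $(x,y)\in\mathbb{R}^2$ lies on $C_4$ if and only if $F(w):=f_0+f_1w+f_2w^2=0$, where $$f_0=r_1r_2(x^2+y^2),\qquad f_1=2\sqrt{r_1r_2}\,\big((r_1+r_2)(x^2+y^2)-2r_1r_2y\big),$$ $$f_2=(r_1^2+r_1r_2+r_2^2)(x^2+y^2)+2r_1r_2(r_2-r_1)x-4r_1r_2(r_1+r_2)y+4r_1^2r_2^2.$$ (iii) Applying the division by zero calculus at $w=0$ to the functions $F(w)$, $F(w)/w$ and $F(w)/w^2$ of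 $w$ (with $x,y$ fixed) and setting the resulting values equal to $0$ gives, respectively, the equations $$x^2+y^2=0,$$ $$(r_1+r_2)(x^2+y^2)-2r_1r_2y=0,$$ $$(r_1^2+r_1r_2+r_2^2)(x^2+y^2)+2r_1r_2(r_2-r_1)x-4r_1r_2(r_1+r_2)y+4r_1^2r_2^2=0.$$ The second is the equation of a circle of radius $\dfrac{r_1r_2}{r_1+r_2}$, and the third is the equation of a circle of radius $\dfrac{r_1r_2(r_1+r_2)}{r_1^2+r_1r_2+r_2^2}$.
   Context: Division by zero calculus: if a function $f$ has a Laurent expansion $f(w)=\sum_{n=-\infty}^{\infty}C_n(w-a)^n$ around $w=a$, its value at $a$ by the division by zero calculus is defined to be $f(a):=C_0$ (with the convention $0^0=1$). Two circles touch if they are tangent to each other (externally or internally). A circle given by an equation $(x-a)^2+(y-b)^2=\rho^2$ with $\rho\neq 0$ real has geometric radius $|\rho|$. *)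

(* Defs.v *)
From Stdlib Require Import Reals ZArith ClassicalEpsilon.
From Coquelicot Require Import Coquelicot.
Open Scope R_scope.

Definition curve := R -> R -> Prop.

Definition is_circle (S : curve) (r : R) : Prop :=
  0 < r /\ exists a b : R, forall x y : R,
    S x y <-> (x - a) ^ 2 + (y - b) ^ 2 = r ^ 2.

(* Two circles are tangent when they meet in exactly one point; this covers
   external and internal tangency, and rules out coinciding circles. *)
Definition touches (S T : curve) : Prop :=
  (exists r : R, is_circle S r) /\
  (exists r : R, is_circle T r) /\
  exists! p : R * R, S (fst p) (snd p) /\ T (fst p) (snd p).

(* f(w) = sum_{n in Z} C_n (w - a)^n on a punctured neighbourhood of a: the
   parts n >= 0 and n < 0 converge separately and their sums add up to f(w).
   The value of f at a itself is irrelevant. *)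
Definition laurent_expansion (f : R -> R) (a : R) (C : Z -> R) : Prop :=
  exists delta : R, 0 < delta /\
    forall w : R, 0 < Rabs (w - a) < delta ->
    exists p q : R,
      is_series (fun n : nat =>
        C (Z.of_nat n) * powerRZ (w - a) (Z.of_nat n)) p /\
      is_series (fun n : nat =>
        C (- Z.of_nat (S n))%Z * powerRZ (w - a) (- Z.of_nat (S n))) q /\
      f w = p + q.

Definition has_laurent (f : R -> R) (a : R) : Prop :=
  exists C : Z -> R, laurent_expansion f a C.

(* Value of f at a by the division by zero calculus: the coefficient C_0
   (an unspecified real if f has no Laurent expansion around a). *)
Definition dbz (f : R -> R) (a : R) : R :=
  epsilon (inhabits 0)
    (fun v : R => exists C : Z -> R, laurent_expansion f a C /\ v = C 0%Z).

Definition circle1 (r1 : R) : curve :=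
  fun x y => (x + r1) ^ 2 + y ^ 2 = r1 ^ 2.

Definition circle2 (r2 : R) : curve :=
  fun x y => (x - r2) ^ 2 + y ^ 2 = r2 ^ 2.

Definition circle3 (r1 r2 w : R) : curve :=
  let z := 1 / w in
  fun x y =>
    (x - (r1 - r2) / (z ^ 2 - 1)) ^ 2
    + (y - 2 * z * sqrt (r1 * r2) / (z ^ 2 - 1)) ^ 2
    = ((r1 + r2) / (z ^ 2 - 1)) ^ 2.

Definition denom (r1 r2 w : R) : R :=
  r1 * r2 + 2 * sqrt (r1 * r2) * (r1 + r2) * w
  + (r1 ^ 2 + r1 * r2 + r2 ^ 2) * w ^ 2.

Definition x4 (r1 r2 w : R) : R :=
  r1 * r2 * (r1 - r2) * w ^ 2 / denom r1 r2 w.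

Definition y4 (r1 r2 w : R) : R :=
  2 * r1 * r2 * (sqrt (r1 * r2) + (r1 + r2) * w) * w / denom r1 r2 w.

Definition r4 (r1 r2 w : R) : R :=
  r1 * r2 * (r1 + r2) * w ^ 2 / denom r1 r2 w.

Definition circle4 (r1 r2 w : R) : curve :=
  fun x y =>
    (x - x4 r1 r2 w) ^ 2 + (y - y4 r1 r2 w) ^ 2 = (r4 r1 r2 w) ^ 2.

Definition f0 (r1 r2 x y : R) : R :=
  r1 * r2 * (x ^ 2 + y ^ 2).

Definition f1 (r1 r2 x y : R) : R :=
  2 * sqrt (r1 * r2) * ((r1 + r2) * (x ^ 2 + y ^ 2) - 2 * r1 * r2 * y).

Definition f2 (r1 r2 x y : R) : R :=
  (r1 ^ 2 + r1 * r2 + r2 ^ 2) * (x ^ 2 + y ^ 2)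
  + 2 * r1 * r2 * (r2 - r1) * x - 4 * r1 * r2 * (r1 + r2) * y
  + 4 * r1 ^ 2 * r2 ^ 2.

Definition F (r1 r2 x y w : R) : R :=
  f0 r1 r2 x y + f1 r1 r2 x y * w + f2 r1 r2 x y * w ^ 2.

(* Main.v *)
Require Import Defs.
From Stdlib Require Import Reals Lra Lia ZArith ClassicalEpsilon.
From Coquelicot Require Import Coquelicot.
Open Scope R_scope.

(** Tangency. Each circle of the configuration is given with a radius that may be
    negative, and in this form all the tangencies look external: the squared
    distance of two centres is the square of the sum of the signed radii. By
    [touches_of_signed_radii] this means tangency as soon as the radii and
    their sum do not vanish. The sum is a nonzero multiple of a sum of two
    squares in each case; for the third and fourth circles it
    could vanish only when [w = -1] and [r1 = r2]. Clearing the denominator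
    [D = denom r1 r2 w] in the equation of the fourth circle gives [F] exactly,
    because
    [x4 ^ 2 + y4 ^ 2 - r4 ^ 2 = 4 * r1 ^ 2 * r2 ^ 2 * w ^ 2 / D].

    Division by zero. [F / w ^ k] is visibly a Laurent polynomial whose
    coefficient of index 0 is [f0], [f1] or [f2]; the point is that the value is
    well defined, that is, that the coefficient [C 0] of a real Laurent
    expansion is determined by the function ([laurent_coef0_unique]). Expansions
    hold on a punctured real interval only, so neither the identity theorem
    on an annulus nor contour integrals apply directly. Instead, let
    [sum_n E_n w ^ n = 0] for [0 < w < delta], with [n] over all the integers.
    Applying [w d/dw] repeatedly gives [sum_n p(n) E_n w ^ n = 0] for every
    even polynomial [p]. Take [p = notch N], which is 1 at 0 and
    vanishes at the integers [n] with [0 < |n| <= N], while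
    [|p(n)| <= exp (2 |n|)] ([notch_le_exp]). At a small enough [w] the terms with
    [|n| > N] are therefore bounded by the tail of one convergent
    series, and [N] tending to infinity yields [E_0 = 0]
    ([laurent_zero_coef0]). *)

(** * Tangent circles *)

Definition circle (a b rho : R) : curve :=
  fun x y => (x - a) ^ 2 + (y - b) ^ 2 = rho ^ 2.

Lemma is_circle_circle (S : curve) (a b rho : R) :
  rho <> 0 -> (forall x y, S x y <-> circle a b rho x y) ->
  is_circle S (Rabs rho).
Proof.
intros Hrho HS; split; [now apply Rabs_pos_lt|].
exists a, b; intros x y; rewrite HS, pow2_abs; reflexivity.
Qed.

Lemma circle_iff_eq0 (a b rho k e x y : R) :
  k <> 0 -> k * ((x - a) ^ 2 + (y - b) ^ 2 - rho ^ 2) = e ->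
  circle a b rho x y <-> e = 0.
Proof.
intros Hk <-; unfold circle; split; intros E.
- rewrite E; ring.
- apply Rmult_integral in E; destruct E; [contradiction|lra].
Qed.

Lemma sum_sqr_eq0 (u v : R) : u ^ 2 + v ^ 2 = 0 -> u = 0 /\ v = 0.
Proof. intros H; split; nra. Qed.

(** A circle may be described with a negative radius. Two circles with signed
    radii [rho] and [sigma] whose centres lie at distance [|rho + sigma|] are
    tangent: externally if the signs agree, internally if they differ. The
    point of contact divides the line of centres in the ratio
    [rho : sigma], and [rho + sigma <> 0] keeps the circles distinct. *)
Lemma touches_of_signed_radii (S T : curve) (a b rho c d sigma : R) :
  (forall x y, S x y <-> circle a b rho x y) ->
  (forall x y, T x y <-> circle c d sigma x y) ->
  rho <> 0 -> sigma <> 0 -> rho + sigma <> 0 ->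
  (a - c) ^ 2 + (b - d) ^ 2 = (rho + sigma) ^ 2 ->
  touches S T.
Proof.
intros HS HT Hr Hs Hrs Hdist.
split; [exists (Rabs rho); now apply is_circle_circle with a b|].
split; [exists (Rabs sigma); now apply is_circle_circle with c d|].
exists ((sigma * a + rho * c) / (rho + sigma),
        (sigma * b + rho * d) / (rho + sigma)).
split; simpl.
- rewrite HS, HT; unfold circle; split.
  + replace ((sigma * a + rho * c) / (rho + sigma) - a)
      with (- (rho * (a - c) / (rho + sigma))) by (field; assumption).
    replace ((sigma * b + rho * d) / (rho + sigma) - b)
      with (- (rho * (b - d) / (rho + sigma))) by (field; assumption).
    transitivity (rho ^ 2 * ((a - c) ^ 2 + (b - d) ^ 2) / (rho + sigma) ^ 2);
      [|rewrite Hdist]; field; assumption.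
  + replace ((sigma * a + rho * c) / (rho + sigma) - c)
      with (sigma * (a - c) / (rho + sigma)) by (field; assumption).
    replace ((sigma * b + rho * d) / (rho + sigma) - d)
      with (sigma * (b - d) / (rho + sigma)) by (field; assumption).
    transitivity (sigma ^ 2 * ((a - c) ^ 2 + (b - d) ^ 2) / (rho + sigma) ^ 2);
      [|rewrite Hdist]; field; assumption.
- intros [x y]; simpl; rewrite HS, HT; unfold circle; intros [H1 H2].
  (* At a common point the vectors to the centres have lengths |rho| and |sigma|
     and their difference has length |rho + sigma|, so their inner product is
     - rho * sigma, and sigma * (x - a, y - b) + rho * (x - c, y - d) = 0. *)
  assert (H : (sigma * (x - a) + rho * (x - c)) ^ 2
              + (sigma * (y - b) + rho * (y - d)) ^ 2 = 0).
  { transitivity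
      ((rho + sigma) * (sigma * ((x - a) ^ 2 + (y - b) ^ 2)
                        + rho * ((x - c) ^ 2 + (y - d) ^ 2))
       - rho * sigma * ((a - c) ^ 2 + (b - d) ^ 2)); [ring|].
    rewrite H1, H2, Hdist; ring. }
  apply sum_sqr_eq0 in H; destruct H as [Hx Hy].
  f_equal; apply (Rmult_eq_reg_r (rho + sigma)); try assumption;
    unfold Rdiv; rewrite Rmult_assoc, Rinv_l, Rmult_1_r by assumption; lra.
Qed.

Lemma circle1E r1 x y : circle1 r1 x y <-> circle (- r1) 0 r1 x y.
Proof.
unfold circle1, circle.
replace (x - - r1) with (x + r1) by ring; rewrite Rminus_0_r; reflexivity.
Qed.

Lemma circle2E r2 x y : circle2 r2 x y <-> circle r2 0 r2 x y.
Proof. unfold circle2, circle; rewrite Rminus_0_r; reflexivity. Qed.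

(** Multiplying through by [w ^ 2] replaces [z = 1 / w]; the radius
    is negative when [1 < w ^ 2]. *)
Lemma circle3E a b w x y : 0 <= a -> 0 <= b -> w <> 0 -> 1 - w ^ 2 <> 0 ->
  circle3 (a ^ 2) (b ^ 2) w x y <->
  circle ((a ^ 2 - b ^ 2) * w ^ 2 / (1 - w ^ 2)) (2 * (a * b) * w / (1 - w ^ 2))
         ((a ^ 2 + b ^ 2) * w ^ 2 / (1 - w ^ 2)) x y.
Proof.
intros Ha Hb Hw Hw1; unfold circle3, circle.
rewrite <- Rpow_mult_distr, sqrt_pow2 by now apply Rmult_le_pos.
replace ((1 / w) ^ 2 - 1) with ((1 - w ^ 2) / w ^ 2) by (field; assumption).
replace ((a ^ 2 - b ^ 2) / ((1 - w ^ 2) / w ^ 2))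
  with ((a ^ 2 - b ^ 2) * w ^ 2 / (1 - w ^ 2)) by (field; auto).
replace (2 * (1 / w) * (a * b) / ((1 - w ^ 2) / w ^ 2))
  with (2 * (a * b) * w / (1 - w ^ 2)) by (field; auto).
replace ((a ^ 2 + b ^ 2) / ((1 - w ^ 2) / w ^ 2))
  with ((a ^ 2 + b ^ 2) * w ^ 2 / (1 - w ^ 2)) by (field; auto).
reflexivity.
Qed.

Lemma sqrt_radii a b : 0 <= a -> 0 <= b -> sqrt (a ^ 2 * b ^ 2) = a * b.
Proof.
intros Ha Hb; rewrite <- Rpow_mult_distr; apply sqrt_pow2; now apply Rmult_le_pos.
Qed.

(** The radii are written [a ^ 2] and [b ^ 2], so that the square root in the
    formulas is the polynomial [a * b] and [field] decides every identity. *)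
Section Configuration.
Variables a b w : R.
Hypotheses (Ha : 0 < a) (Hb : 0 < b).
Hypotheses (Hw0 : w <> 0) (Hw1 : w <> 1) (Hwm1 : w <> -1).

Let D := a ^ 2 * b ^ 2 + 2 * (a * b) * (a ^ 2 + b ^ 2) * w
         + ((a ^ 2) ^ 2 + a ^ 2 * b ^ 2 + (b ^ 2) ^ 2) * w ^ 2.

Lemma one_sub_sqr_neq0 : 1 - w ^ 2 <> 0.
Proof.
replace (1 - w ^ 2) with ((1 - w) * (1 + w)) by ring.
apply Rmult_integral_contrapositive_currified; lra.
Qed.

Let Ha2 : 0 < a ^ 2. Proof. now apply pow_lt. Qed.
Let Hb2 : 0 < b ^ 2. Proof. now apply pow_lt. Qed.
Let Hw2 : 0 < w ^ 2. Proof. pose proof (pow_nonzero w 2 Hw0); pose proof (pow2_ge_0 w); lra. Qed.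

Lemma circle3_touches_circle1 :
  touches (circle3 (a ^ 2) (b ^ 2) w) (circle1 (a ^ 2)).
Proof.
pose proof one_sub_sqr_neq0 as Hn.
assert (Hsum : (a ^ 2 + b ^ 2) * w ^ 2 / (1 - w ^ 2) + a ^ 2
               = (a ^ 2 + b ^ 2 * w ^ 2) / (1 - w ^ 2)) by (field; assumption).
eapply touches_of_signed_radii.
- intros x y; apply circle3E; auto with real.
- apply circle1E.
- apply Rmult_integral_contrapositive_currified;
    [nra|now apply Rinv_neq_0_compat].
- lra.
- rewrite Hsum; apply Rmult_integral_contrapositive_currified;
    [nra|now apply Rinv_neq_0_compat].
- field; assumption.
Qed.

Lemma circle3_touches_circle2 :
  touches (circle3 (a ^ 2) (b ^ 2) w) (circle2 (b ^ 2)).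
Proof.
pose proof one_sub_sqr_neq0 as Hn.
assert (Hsum : (a ^ 2 + b ^ 2) * w ^ 2 / (1 - w ^ 2) + b ^ 2
               = (b ^ 2 + a ^ 2 * w ^ 2) / (1 - w ^ 2)) by (field; assumption).
eapply touches_of_signed_radii.
- intros x y; apply circle3E; auto with real.
- apply circle2E.
- apply Rmult_integral_contrapositive_currified;
    [nra|now apply Rinv_neq_0_compat].
- lra.
- rewrite Hsum; apply Rmult_integral_contrapositive_currified;
    [nra|now apply Rinv_neq_0_compat].
- field; assumption.
Qed.

Lemma denomE : denom (a ^ 2) (b ^ 2) w = D.
Proof. unfold denom; rewrite sqrt_radii by lra; reflexivity. Qed.

Hypothesis HD : denom (a ^ 2) (b ^ 2) w <> 0.

Let x4' := a ^ 2 * b ^ 2 * (a ^ 2 - b ^ 2) * w ^ 2 / D.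
Let y4' := 2 * a ^ 2 * b ^ 2 * (a * b + (a ^ 2 + b ^ 2) * w) * w / D.
Let r4' := a ^ 2 * b ^ 2 * (a ^ 2 + b ^ 2) * w ^ 2 / D.

Let HD' : D <> 0. Proof. now rewrite <- denomE. Qed.

Ltac denom_neq0 := contradict HD'; unfold D; rewrite <- HD'; ring.

Lemma circle4E x y : circle4 (a ^ 2) (b ^ 2) w x y <-> circle x4' y4' r4' x y.
Proof.
unfold circle4, x4, y4, r4; rewrite denomE, sqrt_radii by lra; reflexivity.
Qed.

Lemma r4_neq0 : r4' <> 0.
Proof.
apply Rmult_integral_contrapositive_currified;
  [|now apply Rinv_neq_0_compat].
repeat apply Rmult_integral_contrapositive_currified; lra.
Qed.

(** The sum of the signed radii is a nonzero multiple of a sum of two squares,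
    the second of which is positive since [b] and [w] are nonzero. *)
Lemma circle4_touches_circle1 :
  touches (circle4 (a ^ 2) (b ^ 2) w) (circle1 (a ^ 2)).
Proof.
assert (Hsum : r4' + a ^ 2
    = a ^ 2 * ((a * b + (a ^ 2 + b ^ 2) * w) ^ 2 + (b ^ 2) ^ 2 * w ^ 2) / D)
  by (unfold r4', D; field; denom_neq0).
eapply touches_of_signed_radii;
  [apply circle4E|apply circle1E|exact r4_neq0|lra| |].
- rewrite Hsum; apply Rmult_integral_contrapositive_currified;
    [|now apply Rinv_neq_0_compat].
  assert (0 < (b ^ 2) ^ 2 * w ^ 2) by (apply Rmult_lt_0_compat; [apply pow_lt|]; lra).
  pose proof (pow2_ge_0 (a * b + (a ^ 2 + b ^ 2) * w)).
  apply Rmult_integral_contrapositive_currified; lra.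
- unfold x4', y4', r4', D; field; denom_neq0.
Qed.

Lemma circle4_touches_circle2 :
  touches (circle4 (a ^ 2) (b ^ 2) w) (circle2 (b ^ 2)).
Proof.
assert (Hsum : r4' + b ^ 2
    = b ^ 2 * ((a * b + (a ^ 2 + b ^ 2) * w) ^ 2 + (a ^ 2) ^ 2 * w ^ 2) / D)
  by (unfold r4', D; field; denom_neq0).
eapply touches_of_signed_radii;
  [apply circle4E|apply circle2E|exact r4_neq0|lra| |].
- rewrite Hsum; apply Rmult_integral_contrapositive_currified;
    [|now apply Rinv_neq_0_compat].
  assert (0 < (a ^ 2) ^ 2 * w ^ 2) by (apply Rmult_lt_0_compat; [apply pow_lt|]; lra).
  pose proof (pow2_ge_0 (a * b + (a ^ 2 + b ^ 2) * w)).
  apply Rmult_integral_contrapositive_currified; lra.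
- unfold x4', y4', r4', D; field; denom_neq0.
Qed.

Lemma circle4_touches_circle3 :
  touches (circle4 (a ^ 2) (b ^ 2) w) (circle3 (a ^ 2) (b ^ 2) w).
Proof.
pose proof one_sub_sqr_neq0 as Hn.
(* r4 + r3 is a nonzero multiple of this sum of two squares, which vanishes only
   for a = b and w = -1. *)
set (Q := (2 * (a * b) + (a ^ 2 + b ^ 2) * w) ^ 2 + ((a ^ 2 - b ^ 2) * w) ^ 2).
assert (Hsum : r4' + (a ^ 2 + b ^ 2) * w ^ 2 / (1 - w ^ 2)
    = (a ^ 2 + b ^ 2) * w ^ 2 * (Q / 2) / (D * (1 - w ^ 2)))
  by (unfold r4', Q, D; field; split; [exact Hn|denom_neq0]).
assert (HQ : Q <> 0).
{ intros H; apply sum_sqr_eq0 in H; destruct H as [H1 H2].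
  apply Rmult_integral in H2; destruct H2 as [H2|H2]; [|contradiction].
  assert (Hab : a = b) by nra.
  apply Hwm1; rewrite Hab in H1; nra. }
eapply touches_of_signed_radii;
  [apply circle4E|intros x y; apply circle3E; auto with real|exact r4_neq0| | |].
- apply Rmult_integral_contrapositive_currified;
    [nra|now apply Rinv_neq_0_compat].
- rewrite Hsum; apply Rmult_integral_contrapositive_currified.
  + repeat apply Rmult_integral_contrapositive_currified; lra.
  + apply Rinv_neq_0_compat; now apply Rmult_integral_contrapositive_currified.
- unfold x4', y4', r4', D; field; split; [exact Hn|denom_neq0].
Qed.

Lemma circle4_iff_F x y :
  circle4 (a ^ 2) (b ^ 2) w x y <-> F (a ^ 2) (b ^ 2) x y w = 0.
Proof.
rewrite circle4E; apply circle_iff_eq0 with (1 := HD').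
unfold F, f0, f1, f2; rewrite sqrt_radii by lra.
unfold x4', y4', r4', D; field; denom_neq0.
Qed.

End Configuration.

Lemma is_circle_second (r1 r2 : R) : 0 < r1 -> 0 < r2 ->
  is_circle
    (fun x y => (r1 + r2) * (x ^ 2 + y ^ 2) - 2 * r1 * r2 * y = 0)
    (r1 * r2 / (r1 + r2)).
Proof.
intros H1 H2; split.
- apply Rdiv_lt_0_compat; [now apply Rmult_lt_0_compat|lra].
- exists 0, (r1 * r2 / (r1 + r2)); intros x y; symmetry.
  apply circle_iff_eq0 with (k := r1 + r2); [lra|field; lra].
Qed.

Lemma is_circle_third (r1 r2 : R) : 0 < r1 -> 0 < r2 ->
  is_circle
    (fun x y =>
       (r1 ^ 2 + r1 * r2 + r2 ^ 2) * (x ^ 2 + y ^ 2)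
       + 2 * r1 * r2 * (r2 - r1) * x - 4 * r1 * r2 * (r1 + r2) * y
       + 4 * r1 ^ 2 * r2 ^ 2 = 0)
    (r1 * r2 * (r1 + r2) / (r1 ^ 2 + r1 * r2 + r2 ^ 2)).
Proof.
intros H1 H2.
assert (HE : 0 < r1 ^ 2 + r1 * r2 + r2 ^ 2) by nra.
split.
- apply Rdiv_lt_0_compat; [|exact HE].
  apply Rmult_lt_0_compat; [now apply Rmult_lt_0_compat|lra].
- exists (r1 * r2 * (r1 - r2) / (r1 ^ 2 + r1 * r2 + r2 ^ 2)),
         (2 * r1 * r2 * (r1 + r2) / (r1 ^ 2 + r1 * r2 + r2 ^ 2)).
  intros x y; symmetry.
  apply circle_iff_eq0 with (k := r1 ^ 2 + r1 * r2 + r2 ^ 2);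
    [lra|field; lra].
Qed.

(** * Polynomials vanishing at small nonzero integers *)

(** The even polynomial [prod_(j = 1..N) (1 - (n / j) ^ 2)], which is 1 at 0 and
    vanishes at the other integers of absolute value at most [N]. *)
Fixpoint notch (N n : nat) : R :=
  match N with
  | O => 1
  | S M => notch M n * (1 - (INR n / INR (S M)) ^ 2)
  end.

Lemma notch_0 N : notch N 0 = 1.
Proof.
induction N as [|N IH]; [reflexivity|].
cbn [notch]; rewrite IH; simpl INR at 1; unfold Rdiv; ring.
Qed.

Lemma notch_eq0 N n : (0 < n <= N)%nat -> notch N n = 0.
Proof.
induction N as [|N IH]; intros Hn; [lia|]; cbn [notch].
destruct (Nat.eq_dec n (S N)) as [->|Hne].
- rewrite Rdiv_diag by (apply not_0_INR; lia); ring.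
- rewrite IH by lia; ring.
Qed.

Lemma pow_div_fact_le_exp (x : R) (n : nat) :
  0 <= x -> x ^ n / INR (fact n) <= exp x.
Proof.
intros Hx; apply Rle_trans with (2 := exp_ge_taylor x n Hx).
destruct n as [|n]; [apply Rle_refl|]; rewrite tech5.
rewrite <- (Rplus_0_l (_ / _)) at 1; apply Rplus_le_compat_r.
apply cond_pos_sum; intros k; apply Rmult_le_pos; [now apply pow_le|].
apply Rlt_le, Rinv_0_lt_compat, INR_fact_lt_0.
Qed.

(** For [j <= N <= n] each factor has absolute value at most [(n / j) ^ 2]. *)
Lemma notch_le_fact N n : (N <= n)%nat ->
  Rabs (notch N n) <= (INR n ^ N / INR (fact N)) ^ 2.
Proof.
induction N as [|N IH]; intros HN.
- simpl; rewrite Rabs_R1; lra.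
- assert (HS : 0 < INR (S N)) by (apply lt_0_INR; lia).
  assert (HSn : 1 <= INR n / INR (S N)).
  { apply (Rmult_le_reg_r (INR (S N))); [assumption|].
    unfold Rdiv; rewrite Rmult_assoc, Rinv_l, Rmult_1_l, Rmult_1_r by lra.
    now apply le_INR. }
  replace (INR n ^ S N / INR (fact (S N)))
    with (INR n ^ N / INR (fact N) * (INR n / INR (S N))).
  2:{ rewrite fact_simpl, mult_INR, <- tech_pow_Rmult; field.
      split; (apply INR_fact_neq_0 || lra). }
  cbn [notch]; rewrite Rabs_mult, Rpow_mult_distr.
  apply Rmult_le_compat; try apply Rabs_pos; [apply IH; lia|].
  set (v := INR n / INR (S N)) in *; apply Rabs_le; nra.
Qed.

Lemma exp_INR_mult (n : nat) (x : R) : exp (INR n * x) = exp x ^ n.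
Proof.
induction n as [|n IH]; [simpl; now rewrite Rmult_0_l, exp_0|].
rewrite S_INR, Rmult_plus_distr_r, Rmult_1_l, exp_plus, IH; simpl; ring.
Qed.

(** The bound is exponential in [n] and uniform in [N]: this is what lets
    [N] tend to infinity under the sum of a Laurent series. *)
Lemma notch_le_exp N n : Rabs (notch N n) <= exp 2 ^ n.
Proof.
rewrite <- exp_INR_mult.
assert (Hpos := pos_INR n).
destruct n as [|n].
- rewrite notch_0, Rabs_R1; simpl; rewrite Rmult_0_l, exp_0; lra.
- destruct (le_lt_dec (S n) N) as [H|H].
  + rewrite notch_eq0, Rabs_R0 by lia; apply Rlt_le, exp_pos.
  + apply Rle_trans with (1 := notch_le_fact N (S n) ltac:(lia)).
    replace (exp (INR (S n) * 2)) with (exp (INR (S n)) ^ 2)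
      by (rewrite <- exp_INR_mult; f_equal; simpl INR; ring).
    apply pow_incr; split; [|now apply pow_div_fact_le_exp].
    apply Rmult_le_pos; [now apply pow_le|].
    apply Rlt_le, Rinv_0_lt_compat, INR_fact_lt_0.
Qed.

(** * Uniqueness of the constant Laurent coefficient *)

Lemma CV_radius_ge_ex_pseries (a : nat -> R) (x : R) :
  ex_pseries a x -> Rbar_le (Rabs x) (CV_radius a).
Proof.
intros H; apply Rbar_not_lt_le; intros Hlt.
apply (CV_disk_outside a x Hlt).
now apply ex_series_lim_0, ex_pseries_R.
Qed.

(** The coefficients of [x d/dx] applied to the power series of [a]. *)
Definition euler (a : nat -> R) : nat -> R := PS_incr_1 (PS_derive a).

Lemma eulerE a n : euler a n = INR n * a n.
Proof. destruct n as [|n]; [simpl; unfold zero; simpl; ring|reflexivity]. Qed.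

Lemma CV_radius_euler a : CV_radius (euler a) = CV_radius a.
Proof. unfold euler; now rewrite CV_radius_incr_1, CV_radius_derive. Qed.

Lemma PSeries_euler a x :
  PSeries (euler a) x = x * PSeries (PS_derive a) x.
Proof. apply PSeries_incr_1. Qed.

(** On [0 < w < delta] the series of [a] in [w] and [eps] times that of [b] in
    [1 / w] cancel. The sign [eps] absorbs that [w d/dw] acts as
    [- u d/du] in the variable [u = 1 / w]. *)
Definition laurent_zero (delta eps : R) (a b : nat -> R) : Prop :=
  forall w, 0 < w < delta ->
  ex_pseries a w /\ ex_pseries b (/ w) /\
  PSeries a w + eps * PSeries b (/ w) = 0.

(** Convergence at a larger and at a smaller argument makes the radii of
    convergence strictly larger than the points in use. *)
Lemma laurent_zero_radius delta eps a b w :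
  laurent_zero delta eps a b -> 0 < w < delta ->
  Rbar_lt (Rabs w) (CV_radius a) /\ Rbar_lt (Rabs (/ w)) (CV_radius b).
Proof.
intros H Hw; split.
- destruct (H ((w + delta) / 2) ltac:(lra)) as [Ha _].
  apply CV_radius_ge_ex_pseries in Ha.
  apply Rbar_lt_le_trans with (2 := Ha); simpl.
  rewrite !Rabs_pos_eq by lra; lra.
- destruct (H (w / 2) ltac:(lra)) as [_ [Hb _]].
  apply CV_radius_ge_ex_pseries in Hb.
  apply Rbar_lt_le_trans with (2 := Hb); simpl.
  assert (0 < / w) by (apply Rinv_0_lt_compat; lra).
  replace (/ (w / 2)) with (2 * / w) by (field; lra).
  rewrite !Rabs_pos_eq by lra; lra.
Qed.

Lemma laurent_zero_minus delta eps a b a' b' c :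
  laurent_zero delta eps a b -> laurent_zero delta eps a' b' ->
  laurent_zero delta eps (fun n => a n - c * a' n) (fun n => b n - c * b' n).
Proof.
change (fun n => a n - c * a' n) with (PS_minus a (PS_scal c a')).
change (fun n => b n - c * b' n) with (PS_minus b (PS_scal c b')).
intros H H' w Hw.
destruct (H w Hw) as [Ha [Hb E]]; destruct (H' w Hw) as [Ha' [Hb' E']].
assert (Hca : ex_pseries (PS_scal c a') w)
  by (apply @ex_pseries_scal; [apply Rmult_comm|assumption]).
assert (Hcb : ex_pseries (PS_scal c b') (/ w))
  by (apply @ex_pseries_scal; [apply Rmult_comm|assumption]).
split; [now apply @ex_pseries_minus|split; [now apply @ex_pseries_minus|]].
rewrite !PSeries_minus, !PSeries_scal by assumption.
transitivity ((PSeries a w + eps * PSeries b (/ w))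
              - c * (PSeries a' w + eps * PSeries b' (/ w))); [ring|].
rewrite E, E'; ring.
Qed.

Lemma laurent_zero_ext delta eps a b a' b' :
  (forall n, a n = a' n) -> (forall n, b n = b' n) ->
  laurent_zero delta eps a b -> laurent_zero delta eps a' b'.
Proof.
intros Ha Hb H w Hw; destruct (H w Hw) as [H1 [H2 H3]].
rewrite <- (PSeries_ext a a' w Ha), <- (PSeries_ext b b' (/ w) Hb).
split; [|split; [|assumption]]; now eapply ex_pseries_ext; eauto.
Qed.

(** The sum vanishes on an interval, hence so does its derivative. *)
Lemma laurent_zero_euler delta eps a b :
  laurent_zero delta eps a b ->
  laurent_zero delta (- eps) (euler a) (euler b).
Proof.
intros H w Hw; destruct (laurent_zero_radius _ _ _ _ _ H Hw) as [Ha Hb].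
split; [apply CV_radius_inside; now rewrite CV_radius_euler|].
split; [apply CV_radius_inside; now rewrite CV_radius_euler|].
rewrite !PSeries_euler.
assert (Hw' : 0 < / w) by (apply Rinv_0_lt_compat; lra).
assert (Hd : is_derive (fun v => PSeries a v + eps * PSeries b (/ v)) w
  (PSeries (PS_derive a) w
   + eps * (- / w ^ 2 * PSeries (PS_derive b) (/ w)))).
{ apply @is_derive_plus.
  - now apply is_derive_PSeries.
  - apply is_derive_scal.
    apply (is_derive_comp (PSeries b) Rinv).
    + now apply is_derive_PSeries.
    + auto_derive; [lra|field; lra]. }
assert (H0 : is_derive (fun v => PSeries a v + eps * PSeries b (/ v)) w 0).
{ apply is_derive_ext_loc with (fun _ : R => 0); [|apply @is_derive_const].
  apply (locally_interval _ w 0 delta); simpl; try lra.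
  intros v H1 H2; symmetry; now apply H. }
apply is_derive_unique in Hd; apply is_derive_unique in H0.
rewrite H0 in Hd.
transitivity (w * (PSeries (PS_derive a) w
   + eps * (- / w ^ 2 * PSeries (PS_derive b) (/ w)))).
- field; lra.
- rewrite <- Hd; ring.
Qed.

(** [1 - (n / j) ^ 2] is the eigenvalue of [1 - (w d/dw) ^ 2 / j ^ 2] on both
    [w ^ n] and [w ^ - n], so the vanishing sum may be multiplied termwise by
    these factors one after the other. *)
Lemma laurent_zero_notch delta a b N :
  laurent_zero delta 1 a b ->
  laurent_zero delta 1 (fun n => notch N n * a n) (fun n => notch N n * b n).
Proof.
intros H; induction N as [|N IH].
- apply laurent_zero_ext with (3 := H); intros n; cbn [notch]; ring.
- assert (H2 := laurent_zero_euler _ _ _ _ (laurent_zero_euler _ _ _ _ IH)).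
  rewrite Ropp_involutive in H2.
  eapply laurent_zero_ext with
    (3 := laurent_zero_minus _ _ _ _ _ _ (/ INR (S N) ^ 2) IH H2);
    intros n; cbn [notch]; rewrite !eulerE;
    field; apply not_0_INR; lia.
Qed.

Lemma sum_n_succ (u : nat -> R) (n : nat) :
  sum_n u (S n) = sum_n u n + u (S n).
Proof. exact (sum_Sn u n). Qed.

Lemma head_le_of_is_series_0 (t e : nat -> R) (N : nat) :
  is_series t 0 -> (forall n, (0 < n <= N)%nat -> t n = 0) ->
  ex_series e -> (forall n, Rabs (t n) <= e n) ->
  Rabs (t 0%nat) <= Series e - sum_n e N.
Proof.
intros Ht Ht0 He Hle.
assert (Hsum : sum_n t N = t 0%nat).
{ clear -Ht0; induction N as [|N IH]; [apply sum_O|].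
  rewrite sum_n_succ, IH, (Ht0 (S N)) by (auto with arith || (intros; apply Ht0; lia)).
  apply Rplus_0_r. }
assert (Hlim : is_lim_seq (fun M => Rabs (sum_n t M - sum_n t N)) (Rabs (0 - t 0%nat))).
{ rewrite <- Hsum. apply (is_lim_seq_abs _ (Finite (0 - sum_n t N))).
  apply is_lim_seq_minus'; [exact Ht|apply is_lim_seq_const]. }
assert (Hlim' : is_lim_seq (fun M => sum_n e M - sum_n e N) (Series e - sum_n e N)).
{ apply is_lim_seq_minus'; [now apply Series_correct|apply is_lim_seq_const]. }
rewrite Rminus_0_l, Rabs_Ropp in Hlim.
refine (is_lim_seq_le_loc _ _ (Finite _) (Finite _) _ Hlim Hlim').
exists N; intros M HM.
induction HM as [|M HM IH]; [rewrite !Rminus_diag, Rabs_R0; lra|].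
rewrite !sum_n_succ.
replace (sum_n t M + t (S M) - sum_n t N)
  with ((sum_n t M - sum_n t N) + t (S M)) by ring.
apply Rle_trans with (1 := Rabs_triang _ _).
specialize (Hle (S M)); lra.
Qed.

(** Multiplying the terms by [notch N] keeps the constant one, kills the next [N],
    and enlarges the others at most by the factor [exp 2 ^ n]. The remaining
    tail is thus dominated by the tail of a convergent series when the
    evaluation point [rho] stays in the domain after multiplication and
    division by [exp 2]. *)
Lemma laurent_zero_coef0 delta a b :
  0 < delta -> laurent_zero delta 1 a b -> a 0%nat + b 0%nat = 0.
Proof.
intros Hdelta H.
set (K := exp 2).
assert (HK : 1 < K).
{ unfold K; rewrite <- exp_0; apply exp_increasing; lra. }
set (rho := delta / (2 * K)).
assert (HiK : 0 < / K < 1).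
{ split; [apply Rinv_0_lt_compat; lra|].
  rewrite <- Rinv_1; apply Rinv_lt_contravar; lra. }
assert (Hrho : 0 < rho < delta).
{ unfold rho; replace (delta / (2 * K)) with (delta * / 2 * / K) by (field; lra); nra. }
assert (HKrho : 0 < K * rho < delta).
{ unfold rho; replace (K * (delta / (2 * K))) with (delta / 2) by (field; lra); lra. }
assert (HrhoK : 0 < rho / K < delta).
{ unfold Rdiv; nra. }
set (e := fun n => Rabs (a n * (K * rho) ^ n) + Rabs (b n * (/ (rho / K)) ^ n)).
assert (He : ex_series e).
{ apply @ex_series_plus; apply CV_disk_inside;
    [apply (laurent_zero_radius _ _ _ _ _ H HKrho)
    |apply (laurent_zero_radius _ _ _ _ _ H HrhoK)]. }
(* e dominates termwise the multiplied series at rho, for every N. *)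
assert (Hbound : forall N, Rabs (a 0%nat + b 0%nat) <= Series e - sum_n e N).
{ intros N.
  destruct (laurent_zero_notch _ _ _ N H rho Hrho) as [H1 [H2 H3]].
  set (t := fun n => notch N n * a n * rho ^ n + notch N n * b n * (/ rho) ^ n).
  replace (a 0%nat + b 0%nat) with (t 0%nat)
    by (unfold t; rewrite notch_0; simpl; ring).
  apply head_le_of_is_series_0; auto.
  - rewrite <- H3, Rmult_1_l.
    apply ex_pseries_R in H1; apply ex_pseries_R in H2.
    apply @is_series_plus; now apply Series_correct.
  - intros n Hn; unfold t; rewrite notch_eq0 by assumption; ring.
  - intros n; unfold t, e.
    apply Rle_trans with (1 := Rabs_triang _ _).
    replace (/ (rho / K)) with (K * / rho) by (field; lra).
    rewrite !Rpow_mult_distr, !Rmult_assoc, !Rabs_mult.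
    rewrite (Rabs_pos_eq (K ^ n)) by (apply pow_le; lra).
    assert (Hn := notch_le_exp N n); fold K in Hn.
    pose proof (Rmult_le_pos _ _ (Rabs_pos (a n)) (Rabs_pos (rho ^ n))).
    pose proof (Rmult_le_pos _ _ (Rabs_pos (b n)) (Rabs_pos ((/ rho) ^ n))).
    nra. }
assert (Hlim : is_lim_seq (fun N => Series e - sum_n e N) (Series e - Series e)).
{ apply is_lim_seq_minus'; [apply is_lim_seq_const|now apply Series_correct]. }
rewrite Rminus_diag in Hlim.
assert (Hle := is_lim_seq_le _ _ (Finite _) (Finite _) Hbound (is_lim_seq_const _) Hlim).
simpl in Hle.
apply Rabs_eq_0; apply Rle_antisym; [exact Hle|apply Rabs_pos].
Qed.

Lemma powerRZ_nat (x : R) (n : nat) : powerRZ x (Z.of_nat n) = x ^ n.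
Proof. symmetry; apply pow_powerRZ. Qed.

Lemma powerRZ_opp_nat (x : R) (n : nat) :
  powerRZ x (- Z.of_nat n) = (/ x) ^ n.
Proof. now rewrite powerRZ_neg', <- powerRZ_inv', powerRZ_nat. Qed.

Lemma is_series_sub_ext (u v t : nat -> R) (l m : R) :
  (forall n, u n - v n = t n) ->
  is_series u l -> is_series v m -> is_series t (l - m).
Proof.
intros Ht Hu Hv; apply is_series_ext with (1 := Ht).
exact (is_series_minus u v l m Hu Hv).
Qed.

Lemma is_series_shift (u : nat -> R) (l : R) :
  u 0%nat = 0 -> is_series (fun n => u (S n)) l -> is_series u l.
Proof.
intros H0 H; apply is_series_decr_1.
change (is_series (fun n => u (S n)) (l + - u 0%nat)).
rewrite H0, Ropp_0, Rplus_0_r; exact H.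
Qed.

(** The difference of the two expansions is an expansion of zero, so its constant
    coefficient vanishes. *)
Lemma laurent_coef0_unique f a C C' :
  laurent_expansion f a C -> laurent_expansion f a C' -> C 0%Z = C' 0%Z.
Proof.
intros [d [Hd H]] [d' [Hd' H']].
set (E := fun m => C m - C' m).
(* The constant term belongs to the nonnegative part alone. *)
set (b := fun n => match n with O => 0 | S _ => E (- Z.of_nat n)%Z end).
assert (HE : E 0%Z + b 0%nat = 0).
{ apply (laurent_zero_coef0 (Rmin d d') (fun n => E (Z.of_nat n)) b);
    [now apply Rmin_glb_lt|].
  intros w [Hw0 Hw].
  assert (Hwd := Rlt_le_trans _ _ _ Hw (Rmin_l d d')).
  assert (Hwd' := Rlt_le_trans _ _ _ Hw (Rmin_r d d')).
  specialize (H (a + w)); specialize (H' (a + w)).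
  replace (a + w - a) with w in H, H' by ring.
  rewrite Rabs_pos_eq in H, H' by lra.
  destruct (H (conj Hw0 Hwd)) as [p [q [Hp [Hq Hf]]]].
  destruct (H' (conj Hw0 Hwd')) as [p' [q' [Hp' [Hq' Hf']]]].
  assert (HA : is_pseries (fun n => E (Z.of_nat n)) w (p - p')).
  { apply is_pseries_R.
    apply is_series_sub_ext with (2 := Hp) (3 := Hp').
    intros n; unfold E; cbv beta; rewrite powerRZ_nat; ring. }
  assert (HB : is_pseries b (/ w) (q - q')).
  { apply is_pseries_R, is_series_shift; [apply Rmult_0_l|].
    apply is_series_sub_ext with (2 := Hq) (3 := Hq').
    intros n; unfold b, E; cbv beta; rewrite powerRZ_opp_nat; ring. }
  split; [now exists (p - p')|split; [now exists (q - q')|]].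
  rewrite (is_pseries_unique _ _ _ HA), (is_pseries_unique _ _ _ HB); lra. }
unfold E, b in HE; lra.
Qed.

Lemma dbz_eq_coef0 f a C : laurent_expansion f a C -> dbz f a = C 0%Z.
Proof.
intros H; unfold dbz.
assert (Hex : exists v, exists C', laurent_expansion f a C' /\ v = C' 0%Z) by eauto.
destruct (epsilon_spec (inhabits 0) _ Hex) as [C' [H' ->]].
now apply laurent_coef0_unique with f a.
Qed.

(** * Quadratic polynomials divided by a power of the variable *)

Lemma is_series_eventually_0 (u : nat -> R) (N : nat) :
  (forall n, (N < n)%nat -> u n = 0) -> is_series u (sum_n u N).
Proof.
intros Hu; change (is_lim_seq (sum_n u) (sum_n u N)).
apply is_lim_seq_ext_loc with (fun _ => sum_n u N);
  [|apply is_lim_seq_const].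
exists N; intros M HM; induction HM as [|M HM IH]; [reflexivity|].
rewrite sum_n_succ, <- IH, Hu by lia; symmetry; apply Rplus_0_r.
Qed.

Definition quadratic_coef (c0 c1 c2 : R) (m : Z) : R :=
  match m with
  | 0%Z => c0 | 1%Z => c1 | 2%Z => c2 | _ => 0
  end.

Lemma laurent_quadratic_div (f : R -> R) (c0 c1 c2 : R) (k : nat) :
  (k <= 2)%nat ->
  (forall w, w <> 0 -> f w = (c0 + c1 * w + c2 * w ^ 2) / w ^ k) ->
  laurent_expansion f 0 (fun m => quadratic_coef c0 c1 c2 (m + Z.of_nat k)).
Proof.
intros Hk Hf; exists 1; split; [lra|]; intros w Hw.
rewrite Rminus_0_r in Hw |- *.
assert (Hw0 : w <> 0) by (intros ->; rewrite Rabs_R0 in Hw; lra).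
eexists; eexists; split; [|split].
- apply (is_series_eventually_0 _ 2); intros n Hn.
  destruct n as [|[|[|n]]]; try lia.
  replace (quadratic_coef _ _ _ _) with 0; [ring|].
  unfold quadratic_coef.
  destruct (_ + _)%Z as [|[?|[?|?|]|]|?] eqn:E; lia || reflexivity.
- apply (is_series_eventually_0 _ 2); intros n Hn.
  replace (quadratic_coef _ _ _ _) with 0; [ring|].
  unfold quadratic_coef; destruct (_ + _)%Z as [|?|?] eqn:E; lia || reflexivity.
- rewrite (Hf w Hw0), !sum_n_succ, !sum_O.
  destruct k as [|[|[|k]]]; [| | |lia]; simpl; field; assumption.
Qed.

Lemma dbz_quadratic_div (f : R -> R) (c0 c1 c2 : R) (k : nat) :
  (k <= 2)%nat ->
  (forall w, w <> 0 -> f w = (c0 + c1 * w + c2 * w ^ 2) / w ^ k) ->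
  has_laurent f 0 /\ dbz f 0 = quadratic_coef c0 c1 c2 (Z.of_nat k).
Proof.
intros Hk Hf; assert (H := laurent_quadratic_div f c0 c1 c2 k Hk Hf).
split; [eexists; exact H|exact (dbz_eq_coef0 f 0 _ H)].
Qed.

Lemma mult_eq0_iff (k e : R) : k <> 0 -> k * e = 0 <-> e = 0.
Proof.
intros Hk; split; intros H; [|rewrite H; ring].
apply Rmult_integral in H; tauto.
Qed.

Theorem mainTheorem1 (r1 r2 : R) (hr1 : 0 < r1) (hr2 : 0 < r2) :
  (forall w : R, w <> 0 -> w <> 1 -> w <> -1 ->
     touches (circle3 r1 r2 w) (circle1 r1) /\ touches (circle3 r1 r2 w) (circle2 r2) /\
     (denom r1 r2 w <> 0 ->
        (touches (circle4 r1 r2 w) (circle1 r1) /\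
         touches (circle4 r1 r2 w) (circle2 r2) /\
         touches (circle4 r1 r2 w) (circle3 r1 r2 w)) /\
        (forall x y : R, circle4 r1 r2 w x y <-> F r1 r2 x y w = 0)))
  /\
  (forall x y : R,
     (has_laurent (fun w => F r1 r2 x y w) 0 /\
      (dbz (fun w => F r1 r2 x y w) 0 = 0 <->
       x ^ 2 + y ^ 2 = 0)) /\
     (has_laurent (fun w => F r1 r2 x y w / w) 0 /\
      (dbz (fun w => F r1 r2 x y w / w) 0 = 0 <->
       (r1 + r2) * (x ^ 2 + y ^ 2) - 2 * r1 * r2 * y = 0)) /\
     (has_laurent (fun w => F r1 r2 x y w / w ^ 2) 0 /\
      (dbz (fun w => F r1 r2 x y w / w ^ 2) 0 = 0 <->
       (r1 ^ 2 + r1 * r2 + r2 ^ 2) * (x ^ 2 + y ^ 2)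
       + 2 * r1 * r2 * (r2 - r1) * x - 4 * r1 * r2 * (r1 + r2) * y
       + 4 * r1 ^ 2 * r2 ^ 2 = 0)))
  /\
  is_circle
    (fun x y => (r1 + r2) * (x ^ 2 + y ^ 2) - 2 * r1 * r2 * y = 0)
    (r1 * r2 / (r1 + r2))
  /\
  is_circle
    (fun x y =>
       (r1 ^ 2 + r1 * r2 + r2 ^ 2) * (x ^ 2 + y ^ 2)
       + 2 * r1 * r2 * (r2 - r1) * x - 4 * r1 * r2 * (r1 + r2) * y
       + 4 * r1 ^ 2 * r2 ^ 2 = 0)
    (r1 * r2 * (r1 + r2) / (r1 ^ 2 + r1 * r2 + r2 ^ 2)).
Proof.
split; [|split; [|split]].
- intros w Hw0 Hw1 Hwm1.
  assert (Ha := sqrt_lt_R0 r1 hr1); assert (Hb := sqrt_lt_R0 r2 hr2).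
  rewrite <- (pow2_sqrt r1), <- (pow2_sqrt r2) by lra.
  set (a := sqrt r1) in *; set (b := sqrt r2) in *.
  split; [now apply circle3_touches_circle1|].
  split; [now apply circle3_touches_circle2|].
  intros HD; split; [split; [|split]|intros x y].
  + now apply circle4_touches_circle1.
  + now apply circle4_touches_circle2.
  + now apply circle4_touches_circle3.
  + now apply circle4_iff_F.
- intros x y.
  assert (Hr : 0 < r1 * r2) by now apply Rmult_lt_0_compat.
  assert (Hs := sqrt_lt_R0 _ Hr).
  split; [|split].
  + destruct (dbz_quadratic_div (fun w => F r1 r2 x y w)
      (f0 r1 r2 x y) (f1 r1 r2 x y) (f2 r1 r2 x y) 0 ltac:(lia)) as [HL ->].
    { intros w _; unfold F; rewrite pow_O, Rdiv_1_r; reflexivity. }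
    split; [exact HL|]; apply mult_eq0_iff; lra.
  + destruct (dbz_quadratic_div (fun w => F r1 r2 x y w / w)
      (f0 r1 r2 x y) (f1 r1 r2 x y) (f2 r1 r2 x y) 1 ltac:(lia)) as [HL ->].
    { intros w _; unfold F; rewrite pow_1; reflexivity. }
    split; [exact HL|]; apply mult_eq0_iff; lra.
  + destruct (dbz_quadratic_div (fun w => F r1 r2 x y w / w ^ 2)
      (f0 r1 r2 x y) (f1 r1 r2 x y) (f2 r1 r2 x y) 2 ltac:(lia)) as [HL ->].
    { reflexivity. }
    split; [exact HL|reflexivity].
- now apply is_circle_second.
- now apply is_circle_third.
Qed.
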